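(* Let $\mathcal{S}\subset\{0,1\}^{\mathbb{N}}$ be the set of infinite binary sequences that are not eventually constant, and let $k:\mathcal{S}\to\mathcal{S}$ be the Knave map defined below. There exist $S_{even},S_{odd}\in\mathcal{S}$ such that $k(S_{odd})=S_{even}$ and $k(S_{even})=S_{odd}$; that is, each is the literal description of the bitwise complement of the other. Moreover, this pair is unique: if $A,B\in\mathcal{S}$ satisfy $k(A)=B$ and $k(B)=A$, then $\{A,B\}=\{S_{even},S_{odd}\}$.
   Context: For a positive integer $m$, let $[m]$ denote the standard binary representation of $m$, a string beginning with $1$ and having no leading zeros. Every $S\in\mathcal{S}$ decomposes uniquely as a concatenation $S=r_1r_2r_3\cdots$ of maximal runs: each $r_i$ is a nonempty finite block of a single repeated bit $b_i$, and consecutive runs use different bits. The Knave map is $$k(S)=[|r_1|]\,\overline{b_1}\,[|r_2|]\,\overline{b_2}\,[|r_3|]\,\overline{b_3}\cdots,$$ where $|r_i|$ is the length of $r_i$ and $\overline{b}$ is the complement of the bit $b$. For example, $k(110)=10\,0\,1\,1$. *)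

(* Defs.v *)
From mathcomp Require Import all_boot.
From mathcomp Require Import boolp classical_sets.

Set Implicit Arguments.
Unset Strict Implicit.
Unset Printing Implicit Defensive.

Local Open Scope classical_set_scope.

Definition eventually_constant (s : nat -> bool) : Prop :=
  exists (b : bool) (N : nat), forall n, N <= n -> s n = b.

(* Used as a set and, through the coercion of sets to types, as a type. *)
Definition calS : set (nat -> bool) := [set s | ~ eventually_constant s].

(* Most significant bit first; for m > 0 the first bit is 1.  The value at
   m = 0 is irrelevant: the map is only applied to lengths of runs. *)
Definition binrep (m : nat) : bitseq :=
  rev (mkseq (fun i => odd (m %/ 2 ^ i)) (trunc_log 2 m).+1).

(* w 0 ++ w 1 ++ w 2 ++ ...  When all the words are nonempty, the first n.+1
   of them suffice to reach position n, so the default bit is never used. *)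
Definition concat (w : nat -> bitseq) : nat -> bool :=
  fun n => nth false (flatten (mkseq w n.+1)) n.

Lemma size_flatten_ge (w : nat -> bitseq) :
  (forall i, 0 < size (w i)) -> forall n, n <= size (flatten (mkseq w n)).
Proof.
move=> w_gt0; elim=> // n IHn.
rewrite mkseqS flatten_rcons size_cat.
by rewrite -addn1 leq_add.
Qed.

Lemma flatten_mkseq_cat (w : nat -> bitseq) m n : m <= n ->
  exists t, flatten (mkseq w n) = flatten (mkseq w m) ++ t.
Proof.
elim: n => [|n IHn]; first by rewrite leqn0 => /eqP->; exists [::].
rewrite leq_eqVlt => /orP[/eqP->|]; first by exists [::]; rewrite cats0.
rewrite ltnS => /IHn[t Et]; exists (t ++ w n).
by rewrite mkseqS flatten_rcons Et catA.
Qed.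

Lemma concatE (w : nat -> bitseq) : (forall i, 0 < size (w i)) ->
  forall i j, j < size (w i) ->
    concat w (size (flatten (mkseq w i)) + j) = nth false (w i) j.
Proof.
move=> w_gt0 i j ltj; rewrite /concat.
set p := size _ + j.
have lip : i.+1 <= p.+1.
  by rewrite ltnS (leq_trans (size_flatten_ge w_gt0 i)) // leq_addr.
have [t ->] := flatten_mkseq_cat w lip.
rewrite mkseqS flatten_rcons -catA nth_cat ltnNge leq_addr /= addKn.
by rewrite nth_cat ltj.
Qed.

Lemma calS_change (s : calS) (n : nat) :
  exists m, (n < m) && (\val s m != \val s n).
Proof.
have /set_mem ncs := valP s; apply: contrapT => nex; apply: ncs.
exists (\val s n), n => m; rewrite leq_eqVlt => /orP[/eqP-> //|ltnm].
by apply/eqP; apply: contrapT => /negP neq; apply: nex; exists m; rewrite ltnm.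
Qed.

Definition next_start (s : calS) (n : nat) : nat := ex_minn (calS_change s n).

Definition run_start (s : calS) (i : nat) : nat := iter i (next_start s) 0.

(* The maximal runs r_1, r_2, ... are run s 0, run s 1, ... *)
Definition run (s : calS) (i : nat) : bitseq :=
  [seq \val s j | j <- index_iota (run_start s i) (run_start s i.+1)].

Definition run_bit (s : calS) (i : nat) : bool := \val s (run_start s i).

Lemma next_startP (s : calS) n :
  [/\ n < next_start s n, \val s (next_start s n) = ~~ \val s n
    & forall j, n <= j < next_start s n -> \val s j = \val s n].
Proof.
rewrite /next_start; case: ex_minnP => m /andP[ltnm neq] minm; split => //.
  by case: (\val s m) (\val s n) neq => [] [].
move=> j /andP[]; rewrite leq_eqVlt => /orP[/eqP-> //|ltnj ltjm].
apply/eqP; apply: contraTT ltjm => neqj; rewrite -leqNgt.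
by apply: minm; rewrite ltnj.
Qed.

Lemma size_run (s : calS) i :
  size (run s i) = run_start s i.+1 - run_start s i.
Proof. by rewrite size_map size_iota. Qed.

Lemma run_gt0 (s : calS) i : 0 < size (run s i).
Proof. by rewrite size_run subn_gt0; case: (next_startP s (run_start s i)). Qed.

Lemma run_nseq (s : calS) i : run s i = nseq (size (run s i)) (run_bit s i).
Proof.
apply/all_pred1P/allP => b /mapP[j]; rewrite mem_index_iota => jP ->.
by have [_ _ H] := next_startP s (run_start s i); apply/eqP/H.
Qed.

Lemma run_bitS (s : calS) i : run_bit s i.+1 = ~~ run_bit s i.
Proof. by case: (next_startP s (run_start s i)). Qed.

Lemma flatten_run (s : calS) i :
  flatten (mkseq (run s) i) = mkseq (\val s) (run_start s i).
Proof.
elim: i => // i IHi; rewrite mkseqS flatten_rcons IHi /run /mkseq -map_cat.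
have /ltnW le := let: And3 h _ _ := next_startP s (run_start s i) in h.
congr map; rewrite /index_iota -{2}[run_start s i]add0n -iotaD.
by rewrite subnKC.
Qed.

Lemma concat_run (s : calS) : concat (run s) = \val s.
Proof.
apply/funext => n; rewrite /concat flatten_run nth_mkseq //.
have := size_flatten_ge (run_gt0 s) n.+1.
by rewrite flatten_run size_mkseq.
Qed.

(* [|r_1|] (f b_1) [|r_2|] (f b_2) [|r_3|] (f b_3) ... *)
Definition describe (f : bool -> bool) (s : calS) : nat -> bool :=
  concat (fun i => rcons (binrep (size (run s i))) (f (run_bit s i))).

Lemma describe_calS (f : bool -> bool) (s : calS) :
  injective f -> describe f s \in calS.
Proof.
move=> inj_f; apply/mem_set => -[b [N constN]].
pose w i := rcons (binrep (size (run s i))) (f (run_bit s i)).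
have w_gt0 i : 0 < size (w i) by rewrite size_rcons.
have bE i : N <= i -> f (run_bit s i) = b.
  move=> leNi; pose l := size (binrep (size (run s i))).
  have ltl : l < size (w i) by rewrite size_rcons.
  have := concatE w_gt0 ltl; rewrite {2}/w nth_rcons ltnn eqxx => <-.
  apply: constN; rewrite (leq_trans leNi) //.
  by rewrite (leq_trans (size_flatten_ge w_gt0 i)) // leq_addr.
have := bE N.+1 (leqnSn N); rewrite -(bE N (leqnn N)) run_bitS => /inj_f.
by case: (run_bit s N).
Qed.

Definition knave (s : calS) : calS :=
  exist _ (describe negb s) (describe_calS s negb_inj).

Definition literal_description (s : calS) : calS :=
  exist _ (describe id s) (describe_calS s (@inj_id bool)).

Lemma complement_calS (s : calS) : (fun n => ~~ \val s n) \in calS.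
Proof.
apply/mem_set => -[b [N cst]]; have /set_mem := valP s; apply.
by exists (~~ b), N => n /cst <-; rewrite negbK.
Qed.

Definition complement (s : calS) : calS :=
  exist _ (fun n => ~~ \val s n) (complement_calS s).

(* Main.v *)
Require Import Defs.
From mathcomp Require Import all_boot.
From mathcomp Require Import boolp classical_sets.
From mathcomp Require Import zify.

(* Both members of a pair exchanged by k begin with 1, and the runs of k(S)
   produced by the first 2i+1 runs of S are complete and number at least 2i+2.
   Comparing the two descriptions of each other forces the first runs to be
   1, 1 on both sides; the third runs a, b satisfy a = 2 + f(b), b = 2 + f(a),
   where f(m) is the number of leading ones of [m], so {a, b} = {3, 4}: this is
   the only choice.  The fifth runs satisfy a = 2 + f(b), b = 3 + f(a), hence
   are 3 and 5.  From then on one sequence is two runs ahead of what it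
   describes, so that on sequences with that beginning k o k is a contraction
   for the number of common initial runs: it has exactly one fixed point. *)

Local Open Scope classical_set_scope.

Implicit Types (s t : calS) (x : nat -> bool) (u v : bitseq) (ls : seq nat).

(** * Runs of a sequence and agreement on initial runs *)

Lemma calS_inj s t : \val s =1 \val t -> s = t.
Proof. by move=> st; apply/val_inj/funext. Qed.

Lemma next_start_le s n m :
  n < m -> \val s m != \val s n -> next_start s n <= m.
Proof.
by move=> nm neq; rewrite /next_start; case: ex_minnP => k _; apply; rewrite nm.
Qed.

Lemma next_start_eq s n m : n < m -> \val s m != \val s n ->
  (forall j, n <= j < m -> \val s j = \val s n) -> next_start s n = m.
Proof.
move=> nm neq cst; apply/eqP; rewrite eqn_leq next_start_le //= leqNgt.
have [lt1 flip _] := next_startP s n; apply/negP => lt2.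
have := cst (next_start s n); rewrite (ltnW lt1) lt2 flip => /(_ isT).
by case: (\val s n).
Qed.

Lemma leq_run_start s n : n <= run_start s n.
Proof.
elim: n => // n IHn; rewrite (leq_ltn_trans IHn) //.
by case: (next_startP s (run_start s n)).
Qed.

Lemma run_start_ltS s n : run_start s n < run_start s n.+1.
Proof. by case: (next_startP s (run_start s n)). Qed.

Lemma run_start_homo s m n : m <= n -> run_start s m <= run_start s n.
Proof.
elim: n => [|n IHn]; first by rewrite leqn0 => /eqP->.
rewrite leq_eqVlt => /orP[/eqP-> //|]; rewrite ltnS => /IHn /leq_trans; apply.
exact/ltnW/run_start_ltS.
Qed.

Lemma leq_run_start_trans s m n : m <= n -> m <= run_start s n.
Proof. by move/leq_trans; apply; apply: leq_run_start. Qed.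

Lemma run_bitE s n : run_bit s n = \val s 0 (+) odd n.
Proof.
by elim: n => [|n IHn]; rewrite ?addbF // run_bitS IHn /= addbN.
Qed.

(* The first [n] runs coincide, and so does the bit that follows them. *)
Definition agree n s t := forall j, j <= run_start s n -> \val s j = \val t j.

Lemma agree_le {m n s t} : m <= n -> agree n s t -> agree m s t.
Proof.
by move=> mn st j jm; apply: st; apply: (leq_trans jm); apply: run_start_homo.
Qed.

Lemma agree_run_start n s t : agree n s t ->
  forall i, i <= n -> run_start t i = run_start s i.
Proof.
move=> st; elim=> // i IHi lt_in; rewrite /run_start !iterS.
rewrite -!/(run_start _ _) (IHi (ltnW lt_in)).
have [lt1 flip cst] := next_startP s (run_start s i).
have le1 : next_start s (run_start s i) <= run_start s n.
  exact: (run_start_homo _ i.+1 _ lt_in).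
apply: next_start_eq => //.
  by rewrite -!st ?flip ?(leq_trans (ltnW lt1)) //; case: (\val s _).
by move=> j /andP[j1 j2]; rewrite -!st ?cst ?j1 //; lia.
Qed.

(** * The words of the Knave description *)

Definition word s i : bitseq :=
  rcons (binrep (size (run s i))) (~~ run_bit s i).

Definition words_size s n : nat := size (flatten (mkseq (word s) n)).

Lemma size_binrep m : size (binrep m) = (trunc_log 2 m).+1.
Proof. by rewrite size_rev size_mkseq. Qed.

Lemma head_binrep m : 0 < m -> head false (binrep m) = true.
Proof.
move=> m_gt0; rewrite /binrep mkseqS rev_rcons /=.
have /andP[le1 lt2] := trunc_log_bounds (isT : 1 < 2) m_gt0.
have -> // : m %/ 2 ^ trunc_log 2 m = 1.
by apply/eqP; rewrite eqn_leq -ltnS ltn_divLR ?expn_gt0 // -expnS lt2 divn_gt0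
  ?expn_gt0.
Qed.

Lemma word_gt1 s i : 1 < size (word s i).
Proof. by rewrite size_rcons size_binrep. Qed.

Lemma word_gt0 s i : 0 < size (word s i).
Proof. exact/ltnW/word_gt1. Qed.

Lemma words_sizeS s n : words_size s n.+1 = words_size s n + size (word s n).
Proof. by rewrite /words_size mkseqS flatten_rcons size_cat. Qed.

Lemma knave_word s i j : j < size (word s i) ->
  \val (knave s) (words_size s i + j) = nth false (word s i) j.
Proof. exact: (concatE (word_gt0 s)). Qed.

Lemma knave_word_head s i : \val (knave s) (words_size s i) = true.
Proof.
rewrite -[X in \val _ X]addn0 knave_word ?word_gt0 //.
by rewrite /word nth_rcons size_binrep /= nth0 head_binrep ?run_gt0.
Qed.

Lemma knave_word_last s i :
  \val (knave s) (words_size s i.+1).-1 = ~~ run_bit s i.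
Proof.
rewrite words_sizeS size_rcons addnS knave_word ?size_rcons //.
by rewrite nth_rcons ltnn eqxx.
Qed.

Lemma knave0 s : \val (knave s) 0 = true.
Proof. exact: (knave_word_head s 0). Qed.

Lemma knave_prefix s n j : j < words_size s n ->
  \val (knave s) j = nth false (flatten (mkseq (word s) n)) j.
Proof.
move=> jn; rewrite /= /describe /concat -/(word s).
have jj := size_flatten_ge (word_gt0 s) j.+1.
case: (leqP n j.+1) => [|/ltnW] le; have [t Et] := flatten_mkseq_cat (word s) le.
  by rewrite Et nth_cat jn.
by rewrite Et nth_cat jj.
Qed.

(** Common runs give common words, and the next word begins with 1 on both sides. Hence the images
    also agree at position [words_size s n] itself, the closing bit of run [m - 1] when the bound is
    attained. *)
Lemma agree_knave n m s t : agree n s t ->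
  run_start (knave s) m <= words_size s n -> agree m (knave s) (knave t).
Proof.
move=> st le_m j le_j.
have ws : mkseq (word t) n = mkseq (word s) n.
  apply/eq_in_map => i; rewrite mem_iota /= add0n => lt_in.
  rewrite /word !size_run !(agree_run_start _ _ _ st) ?(ltnW lt_in) // !run_bitE.
  by rewrite st.
have wst : words_size t n = words_size s n by rewrite /words_size ws.
have := leq_trans le_j le_m; rewrite leq_eqVlt => /orP[/eqP->|ltj].
  by rewrite knave_word_head -wst knave_word_head.
by rewrite !(knave_prefix _ n) ?ws ?wst.
Qed.

(** * Counting the runs completed by the first words *)

(** Run [n] consists of ones, since [n] is even. The 0 at [q.-1] comes after its start and the 1 at
    [q] after that 0, so two further runs have begun by [q]. *)
Lemma run_start_two s n p q : ~~ odd n -> \val s 0 -> run_start s n <= p ->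
  p < q.-1 -> \val s q.-1 = false -> \val s q = true -> run_start s n.+2 <= q.
Proof.
move=> even_n s0 le_p lt_pq s1 s2.
have b0 : \val s (run_start s n) = true.
  by rewrite -/(run_bit s n) run_bitE s0 (negPf even_n).
have b1 : \val s (run_start s n.+1) = false.
  by rewrite -/(run_bit s n.+1) run_bitE s0 /= (negPf even_n).
have le1 : run_start s n.+1 <= q.-1.
  by apply: next_start_le; [exact: leq_ltn_trans le_p lt_pq | rewrite s1 b0].
have lt1 : run_start s n.+1 < q by lia.
by apply: next_start_le; [exact: lt1 | rewrite s2 b1].
Qed.

(* The words describing a run of zeros and the next run of ones form a block
   [c]1[d]0 which is followed by 1, so they contribute at least two runs. *)
Lemma run_start_knave_step s n i : \val s 0 -> ~~ odd n ->
  run_start (knave s) n <= words_size s i.*2.+1 ->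
  run_start (knave s) n.+2 <= words_size s i.+1.*2.+1.
Proof.
move=> s0 even_n le_n.
apply: (run_start_two _ _ _ _ even_n (knave0 s) le_n); last exact: knave_word_head.
  by rewrite doubleS !words_sizeS; have := word_gt1 s i.*2.+2; lia.
by rewrite knave_word_last run_bitE s0 /= odd_double.
Qed.

Lemma run_start_knave_shift s n k i : \val s 0 -> ~~ odd n ->
  run_start (knave s) n <= words_size s k.*2.+1 ->
  run_start (knave s) (n + i.*2) <= words_size s (k + i).*2.+1.
Proof.
move=> s0 even_n le_n; elim: i => [|i IHi]; first by rewrite !addn0.
rewrite doubleS !addnS; apply: run_start_knave_step => //.
by rewrite oddD odd_double addbF.
Qed.

Lemma run_start_knave s i : \val s 0 ->
  run_start (knave s) i.*2.+2 <= words_size s i.*2.+1.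
Proof.
move=> s0; apply: (run_start_knave_shift s 2 0 i s0) => //.
(* Base case: the first word begins with 1, ends in 0 and is followed by 1. *)
have last0 := knave_word_last s 0; rewrite run_bitE s0 /= in last0.
apply: (run_start_two _ 0 0 _ _ (knave0 s)); rewrite ?knave_word_head //.
by rewrite words_sizeS size_rcons size_binrep; lia.
Qed.

(** * Prefixes given by their run lengths *)

Definition runs s n : seq nat := mkseq (fun i => size (run s i)) n.

(* Includes the first bit of the run after those listed, so that the listed
   lengths are those of maximal runs. *)
Fixpoint unrle (b : bool) ls : bitseq :=
  if ls is l :: ls' then nseq l b ++ unrle (~~ b) ls' else [:: b].

(** A computable form of the words, so that images of explicit prefixes are found by evaluation. *)
Fixpoint kwords (b : bool) ls : seq bitseq :=
  if ls is l :: ls' then rcons (binrep l) (~~ b) :: kwords (~~ b) ls' else [::].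

Definition begins x u := forall j, j < size u -> x j = nth false u j.

Lemma begins_cat x u v : begins x (u ++ v) -> begins x u.
Proof.
by move=> H j ju; rewrite H ?nth_cat ?ju // size_cat ltn_addr.
Qed.

Lemma iter_next_start s b ls n : all (leq 1) ls ->
  (forall j, j < size (unrle b ls) -> \val s (n + j) = nth false (unrle b ls) j) ->
  forall i, i <= size ls -> iter i (next_start s) n = n + sumn (take i ls).
Proof.
elim: ls b n => [|l ls IHls] b n; first by move=> _ _ [|]; rewrite ?addn0.
move=> /andP[l_gt0 ls_gt0]; rewrite [unrle _ _]/= => H [|i]; rewrite ?addn0 // ltnS => le_i.
have size_gt0 c ks : 0 < size (unrle c ks).
  by elim: ks c => //= k ks IH c; rewrite size_cat ltn_addl.
have head_unrle c ks : all (leq 1) ks -> nth false (unrle c ks) 0 = c.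
  by case: ks => //= -[].
have Hl j : j < l -> \val s (n + j) = b.
  by move=> jl; rewrite H ?size_cat ?size_nseq ?ltn_addr // nth_cat size_nseq jl nth_nseq jl.
have Hn : next_start s n = n + l.
  have Hb := Hl 0 l_gt0; rewrite addn0 in Hb.
  apply: next_start_eq; rewrite ?Hb; first by lia.
    rewrite H ?size_cat ?size_nseq; last by have := size_gt0 (~~ b) ls; lia.
    by rewrite nth_cat size_nseq ltnn subnn head_unrle //; case: (b).
  by move=> j jP; rewrite (_ : j = n + (j - n)) ?Hl //; lia.
rewrite iterSr Hn /= addnA; apply: (IHls (~~ b)) => // j jP.
rewrite -addnA H ?size_cat ?size_nseq ?ltn_add2l //.
by rewrite nth_cat size_nseq ltnNge leq_addr /= addKn.
Qed.

Lemma begins_run_start s b ls i : all (leq 1) ls -> begins (\val s) (unrle b ls) ->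
  i <= size ls -> run_start s i = sumn (take i ls).
Proof. by move=> ls_gt0 H ile; apply: (iter_next_start s b ls 0). Qed.

Lemma begins_size_run s b ls i : all (leq 1) ls -> begins (\val s) (unrle b ls) ->
  i < size ls -> size (run s i) = nth 0 ls i.
Proof.
move=> ls_gt0 H ilt; rewrite size_run !(begins_run_start s b ls) ?(ltnW ilt) //.
by rewrite (take_nth 0) // sumn_rcons addKn.
Qed.

Lemma begins_agree s t b ls : all (leq 1) ls ->
  begins (\val s) (unrle b ls) -> begins (\val t) (unrle b ls) ->
  agree (size ls) s t.
Proof.
move=> ls_gt0 Hs Ht j; rewrite (begins_run_start s b ls) // take_size => jP.
have lt_j : j < size (unrle b ls).
  rewrite (leq_ltn_trans jP) //; elim: ls b {ls_gt0 Hs Ht jP} => //= l ls IH b.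
  by rewrite size_cat size_nseq -addnS leq_add2l.
by rewrite Hs ?Ht.
Qed.

Lemma mkseq_word s n :
  mkseq (word s) n = kwords (\val s 0) (runs s n).
Proof.
rewrite -[\val s 0]/(run_bit s 0) /runs /mkseq; elim: n 0 => //= n IHn i.
by rewrite IHn run_bitS.
Qed.

Lemma begins_knave_runs s n : \val s 0 -> begins (\val (knave s))
  (rcons (flatten (kwords true (runs s n))) true).
Proof.
move=> s0 j; rewrite -s0 -mkseq_word size_rcons ltnS nth_rcons.
rewrite -/(words_size s n) leq_eqVlt => /orP[/eqP->|ltj].
  by rewrite knave_word_head ltnn eqxx.
by rewrite ltj -knave_prefix.
Qed.

Lemma begins_runs s ls n : all (leq 1) ls -> begins (\val s) (unrle true ls) ->
  n <= size ls -> runs s n = take n ls.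
Proof.
move=> ls_gt0 H le_n; apply: (@eq_from_nth _ 0); rewrite size_mkseq ?size_takel // => i ilt.
by rewrite nth_mkseq // nth_take // (begins_size_run s true ls) // (leq_trans ilt).
Qed.

Lemma begins_head s ls : all (leq 1) ls -> begins (\val s) (unrle true ls) -> \val s 0.
Proof. by case: ls => [|[|l] ls] //= _ ->. Qed.

Lemma begins_words_size s ls n : all (leq 1) ls -> begins (\val s) (unrle true ls) ->
  n <= size ls -> words_size s n = size (flatten (kwords true (take n ls))).
Proof.
move=> ls_gt0 H le_n; rewrite /words_size mkseq_word (begins_runs s ls) //.
by rewrite (begins_head s ls).
Qed.

Lemma begins_knave s ls : all (leq 1) ls -> begins (\val s) (unrle true ls) ->
  begins (\val (knave s)) (rcons (flatten (kwords true ls)) true).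
Proof.
move=> ls_gt0 H; rewrite -(take_size ls) -(begins_runs s ls) //.
exact/begins_knave_runs/(begins_head s ls).
Qed.

Lemma begins_prefix x u v : prefix u v -> begins x v -> begins x u.
Proof. by move=> /prefixP[t ->]; apply: begins_cat. Qed.

(** * The square of the Knave map as a contraction *)

(* Run lengths at the beginning of the two members of the pair. *)
Definition start1 := [:: 1; 1; 3; 3; 3; 1; 1; 1].
Definition start2 := [:: 1; 1; 4; 1; 5; 1].

Lemma knave_start1 s : begins (\val s) (unrle true start1) ->
  begins (\val (knave s)) (unrle true start2).
Proof. by move=> /begins_knave H; apply: begins_prefix (H _). Qed.

Lemma knave_start2 s : begins (\val s) (unrle true start2) ->
  begins (\val (knave s)) (unrle true start1).
Proof. by move=> /begins_knave H; apply: begins_prefix (H _). Qed.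

Definition knave2 s := knave (knave s).

Lemma knave2_start1 s : begins (\val s) (unrle true start1) ->
  begins (\val (knave2 s)) (unrle true start1).
Proof. by move=> /knave_start1/knave_start2. Qed.

(* The first five runs of [knave s], 1 0 1111 0 11111, are described by eight
   runs instead of the guaranteed six; this lead of two is never lost. *)
Lemma run_start_knave2 s i : begins (\val s) (unrle true start1) ->
  run_start (knave2 s) (8 + i.*2) <= words_size (knave s) (2 + i).*2.+1.
Proof.
move=> H; have H1 := knave_start1 s H; have H2 := knave2_start1 s H.
apply: run_start_knave_shift => //; first exact: knave0.
rewrite (begins_run_start _ _ _ _ _ H2) //.
by rewrite (begins_words_size _ start2).
Qed.

(** The first application of [knave] preserves the number of common runs; the second gains two,
    because [knave s] begins with [start2]. *)
Lemma agree_knave2 s t i : begins (\val s) (unrle true start1) ->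
  agree (8 + i.*2) s t -> agree (8 + i.+1.*2) (knave2 s) (knave2 t).
Proof.
move=> H st; have s0 := begins_head s start1 isT H.
have st1 : agree (8 + i.*2) (knave s) (knave t).
  apply: (agree_knave (3 + i).*2.+1); first by apply: agree_le st; lia.
  by have := run_start_knave s (3 + i) s0; rewrite !doubleD.
apply: (agree_knave (2 + i.+1).*2.+1); last exact: run_start_knave2.
by apply: agree_le st1; lia.
Qed.

Lemma agree_eq s t : (forall n, agree n s t) -> s = t.
Proof. by move=> st; apply: calS_inj => n; apply: (st n); apply: leq_run_start. Qed.

Lemma knave2_fixed_unique s t : begins (\val s) (unrle true start1) ->
  begins (\val t) (unrle true start1) -> knave2 s = s -> knave2 t = t -> s = t.
Proof.
move=> Hs Ht fs ft; apply: agree_eq => n.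
suff H i : agree (8 + i.*2) s t by apply: agree_le (H n); lia.
elim: i => [|i IHi]; first exact: (begins_agree _ _ true start1).
by rewrite -fs -ft; apply: agree_knave2.
Qed.

(** * Existence: a fixed point as the limit of iterates *)

(** The runs of [start1] have total length 14. The alternating tail starts with a 1, which closes
    the eighth run, and it is never constant. *)
Definition seed_seq j :=
  if j < 14 then nth false (unrle true start1) j else ~~ odd j.

Lemma seed_calS : seed_seq \in calS.
Proof.
apply/mem_set => -[b [N cst]].
have E j : (14 + j < 14) = false by lia.
have := cst (14 + N.+1); rewrite -(cst (14 + N) (leq_addl _ _)) /seed_seq !E.
by rewrite addnS (leqW (leq_addl _ _)) /= => /(_ isT); case: (odd _).
Qed.

Definition seed : calS := exist _ seed_seq seed_calS.

Lemma seed_start1 : begins (\val seed) (unrle true start1).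
Proof. by do 15![case=> //]. Qed.

Definition iterate n := iter n knave2 seed.

Lemma iterate_start1 n : begins (\val (iterate n)) (unrle true start1).
Proof. by elim: n => [|n]; [exact: seed_start1 | apply: knave2_start1]. Qed.

Lemma iterate_agree m n : m <= n -> agree (8 + m.*2) (iterate m) (iterate n).
Proof.
elim: m n => [|m IHm] n.
  by move=> _; apply: (begins_agree _ _ true start1) => //; apply: iterate_start1.
by case: n => // n /IHm; apply: agree_knave2; apply: iterate_start1.
Qed.

(** A diagonal: bit [j] is final from iterate [j] on, as [8 + j.*2] runs reach beyond position
    [j]. *)
Definition limit_seq j := \val (iterate j) j.

Lemma limit_seqE n j : j <= run_start (iterate n) (8 + n.*2) ->
  limit_seq j = \val (iterate n) j.
Proof.
move=> jn; case: (leqP n j) => [nj|/ltnW jn'].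
  by rewrite /limit_seq (iterate_agree n j).
rewrite /limit_seq; apply: (iterate_agree j n) => //.
by apply: leq_run_start_trans; lia.
Qed.

Lemma limit_calS : limit_seq \in calS.
Proof.
apply/mem_set => -[b [N cst]].
(* Runs [N] and [N.+1] of [iterate N] start at or after [N], where the limit copies this iterate,
   and their bits differ. *)
have E i : N <= i <= 8 + N.*2 -> run_bit (iterate N) i = b.
  move=> /andP[Ni iN]; rewrite /run_bit -(limit_seqE N) ?run_start_homo //.
  by apply: cst; rewrite (leq_trans Ni) ?leq_run_start.
have := E N.+1; rewrite run_bitS E; last by lia.
by have -> : N <= N.+1 <= 8 + N.*2 by [lia]; move=> /(_ isT); case: (b).
Qed.

Definition limit : calS := exist _ limit_seq limit_calS.

Lemma limit_agree n : agree (8 + n.*2) (iterate n) limit.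
Proof. by move=> j /limit_seqE. Qed.

Lemma limit_start1 : begins (\val limit) (unrle true start1).
Proof.
move=> j jlt; rewrite -(iterate_start1 0 j jlt) /= (limit_seqE 0) //.
by rewrite (begins_run_start _ _ _ _ _ (iterate_start1 0)).
Qed.

(** By contraction [knave2 limit] agrees with [iterate j.+1] far enough to include bit [j], and so
    does [limit]. *)
Lemma knave2_limit : knave2 limit = limit.
Proof.
apply: calS_inj => j.
have le : j <= run_start (iterate j.+1) (8 + j.+1.*2).
  by apply: leq_run_start_trans; lia.
rewrite -(limit_agree j.+1) //.
by rewrite -(agree_knave2 _ _ _ (iterate_start1 j) (limit_agree j)).
Qed.

(** * Uniqueness: the forced beginning of a pair *)

Definition lead_ones m := find negb (binrep m).

(** The appended 0 stops the leading ones even when all the binary digits are ones. *)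
Lemma rcons_binrep m :
  prefix (nseq (lead_ones m) true ++ [:: false]) (rcons (binrep m) false).
Proof.
rewrite /lead_ones; elim: (binrep m) => //= -[] u IHu //=.
by rewrite prefix0s.
Qed.

Lemma lead_ones_bound m : (lead_ones m).*2 <= m.+2.
Proof.
have le1 : lead_ones m <= (trunc_log 2 m).+1 by rewrite -size_binrep find_size.
case: m le1 => [|m] le1; first by rewrite (leq_double _ 1).
have := trunc_logP (isT : 1 < 2) (ltn0Sn m).
case: (trunc_log 2 m.+1) le1 => [|k] le1; first by lia.
by rewrite expnS; have := ltn_expl k (isT : 1 < 2); lia.
Qed.

(** The bound on leading ones gives [2a <= b + 8] and [2b <= a + 8], hence both are at most 8. *)
Lemma lead_ones_cycle p q a b : a = p + lead_ones b -> b = q + lead_ones a ->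
  p <= 3 -> q <= 3 -> (a < 9) && (b < 9).
Proof. by move=> *; have := lead_ones_bound a; have := lead_ones_bound b; lia. Qed.

(** Only 81 pairs remain, so the solutions are found by evaluation. *)
Lemma lead_ones_cycle_in (P : rel nat) p q a b : p <= 3 -> q <= 3 ->
  a = p + lead_ones b -> b = q + lead_ones a ->
  all (fun a => all (fun b => (a == p + lead_ones b) && (b == q + lead_ones a) ==> P a b)
    (iota 0 9)) (iota 0 9) -> P a b.
Proof.
move=> p3 q3 Ea Eb; have /andP[a9 b9] := lead_ones_cycle p q a b Ea Eb p3 q3.
move=> /allP/(_ a); rewrite mem_iota => /(_ a9)/allP/(_ b); rewrite mem_iota => /(_ b9).
by rewrite -Ea -Eb !eqxx.
Qed.

Lemma kwords_rcons b ls m : flatten (kwords b (rcons ls m)) =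
  flatten (kwords b ls) ++ rcons (binrep m) (~~ (b (+) odd (size ls))).
Proof.
elim: ls b => [|l ls IHls] b /=; first by rewrite cats0 addbF.
by rewrite IHls catA addNb addbN.
Qed.

Lemma unrle_rcons b ls : exists u, unrle b ls = rcons u (b (+) odd (size ls)) /\
  forall l, unrle b (rcons ls l) =
    u ++ nseq l (b (+) odd (size ls)) ++ [:: ~~ (b (+) odd (size ls))].
Proof.
elim: ls b => [|l ls IHls] b; first by exists [::]; rewrite /= addbF.
have [u [E1 E2]] := IHls (~~ b); exists (nseq l b ++ u).
have -> : b (+) odd (size (l :: ls)) = ~~ b (+) odd (size ls) by rewrite addNb addbN.
by split=> [|k]; rewrite /= ?E1 ?E2 ?rcons_cat ?catA.
Qed.

(* [knave s] has [p] ones pending in its current run when it starts describing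
   the first run of [s] after those listed in [ls]. *)
Lemma knave_pending_run s ls ls' p : \val s 0 -> ~~ odd (size ls) ->
  ~~ odd (size ls') -> all (leq 1) ls' ->
  runs s (size ls) = ls ->
  rcons (flatten (kwords true ls)) true = unrle true ls' ++ nseq p true ->
  size (run (knave s) (size ls')) = p + lead_ones (size (run s (size ls))).
Proof.
move=> s0 even_ls even_ls' ls'_gt0 Els Ep.
set m := size (run s _).
have H := begins_knave_runs s (size ls).+1 s0.
rewrite /runs mkseqS -/(runs s _) Els kwords_rcons (negPf even_ls) addbF /= -/m in H.
have [u [E1 E2]] := unrle_rcons true ls'.
rewrite (negPf even_ls') addbF /= in E1 E2.
(* The marker bit of [unrle] and the [p] pending bits are [p.+1] ones; the last of them belongs to
   the next word. *)
have Eu : flatten (kwords true ls) = u ++ nseq p true.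
  have := Ep; rewrite E1 cat_rcons -[true :: nseq p true]/(nseq p.+1 true).
  by rewrite -addn1 nseqD cats1 -rcons_cat => /rcons_inj[].
have Hb : begins (\val (knave s)) (unrle true (rcons ls' (p + lead_ones m))).
  have /prefixP[v Ev] := rcons_binrep m.
  apply: begins_prefix H; apply/prefixP; exists (rcons v true).
  by rewrite E2 Eu Ev nseqD -!cats1 -!catA.
have pos : 0 < lead_ones m.
  have := head_binrep m (run_gt0 s _).
  by rewrite /lead_ones; case: (binrep m) => //= -[].
rewrite (begins_size_run _ _ _ _ _ Hb) ?size_rcons // ?nth_rcons ?ltnn ?eqxx //.
by rewrite all_rcons ls'_gt0 andbT addn_gt0 pos orbT.
Qed.

Lemma knave_runs s n ls ls' : \val s 0 -> runs s n = ls -> all (leq 1) ls' ->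
  prefix (unrle true ls') (rcons (flatten (kwords true ls)) true) ->
  runs (knave s) (size ls') = ls'.
Proof.
move=> s0 Els ls'_gt0 /begins_prefix H.
rewrite (begins_runs _ ls') ?take_size //; apply: H; rewrite -Els.
exact: begins_knave_runs.
Qed.

Lemma runsS s n : runs s n.+1 = rcons (runs s n) (size (run s n)).
Proof. exact: mkseqS. Qed.

Lemma knave_pair_third_run s t : knave s = t -> knave t = s ->
  [/\ runs s 2 = [:: 1; 1], runs t 2 = [:: 1; 1] &
    (size (run s 2) == 3) && (size (run t 2) == 4) ||
    (size (run s 2) == 4) && (size (run t 2) == 3)].
Proof.
move=> st ts.
have s0 : \val s 0 by rewrite -ts knave0.
have t0 : \val t 0 by rewrite -st knave0.
have Et : size (run t 0) = 0 + lead_ones (size (run s 0)).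
  by rewrite -st; apply: (knave_pending_run s [::] [::] 0).
have Es : size (run s 0) = 0 + lead_ones (size (run t 0)).
  by rewrite -{1}ts; apply: (knave_pending_run t [::] [::] 0).
(* As [binrep 0] is [[:: false]], the pair of zeros also solves the equations; nonempty runs exclude
   it. *)
have /andP[/eqP s1 /eqP t1] : (size (run s 0) == 1) && (size (run t 0) == 1).
  apply: (implyP _ (run_gt0 s 0)).
  by apply: (lead_ones_cycle_in (fun a b => (0 < a) ==> (a == 1) && (b == 1)) _ _ _ _ _ _ Es Et).
have Rs : runs s 2 = [:: 1; 1].
  by rewrite -ts; apply: (knave_runs t 1 [:: 1] [:: 1; 1]); rewrite ?runsS ?t1.
have Rt : runs t 2 = [:: 1; 1].
  by rewrite -st; apply: (knave_runs s 1 [:: 1] [:: 1; 1]); rewrite ?runsS ?s1.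
split=> //.
(* The words [10], [11] yield the runs 1, 0 and leave two ones pending. *)
have Et2 : size (run t 2) = 2 + lead_ones (size (run s 2)).
  by rewrite -st; apply: (knave_pending_run s [:: 1; 1] [:: 1; 1] 2).
have Es2 : size (run s 2) = 2 + lead_ones (size (run t 2)).
  by rewrite -{1}ts; apply: (knave_pending_run t [:: 1; 1] [:: 1; 1] 2).
by apply: (lead_ones_cycle_in
  (fun a b => (a == 3) && (b == 4) || (a == 4) && (b == 3)) _ _ _ _ _ _ Es2 Et2).
Qed.

Lemma knave_pair_start1 s t : knave s = t -> knave t = s ->
  runs s 3 = [:: 1; 1; 3] -> runs t 3 = [:: 1; 1; 4] ->
  begins (\val s) (unrle true start1).
Proof.
move=> st ts Rs Rt.
have s0 : \val s 0 by rewrite -ts knave0.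
have t0 : \val t 0 by rewrite -st knave0.
have {}Rs : runs s 4 = [:: 1; 1; 3; 3].
  by rewrite -ts; apply: (knave_runs t 3 _ [:: 1; 1; 3; 3] t0 Rt).
have {}Rt : runs t 4 = [:: 1; 1; 4; 1].
  by rewrite -st; apply: (knave_runs s 4 _ [:: 1; 1; 4; 1] s0 Rs).
(* The fourth words, [111] for [s] and [11] for [t], leave three and two ones pending. *)
have Et : size (run t 4) = 3 + lead_ones (size (run s 4)).
  by rewrite -st; apply: (knave_pending_run s [:: 1; 1; 3; 3] [:: 1; 1; 4; 1] 3).
have Es : size (run s 4) = 2 + lead_ones (size (run t 4)).
  by rewrite -{1}ts; apply: (knave_pending_run t [:: 1; 1; 4; 1] [:: 1; 1; 3; 3] 2).
have /eqP t5 : size (run t 4) == 5.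
  by apply: (lead_ones_cycle_in (fun _ b => b == 5) _ _ _ _ _ _ Es Et).
(* The runs 1, 1, 4, 1, 5 of [t] already describe all of [start1]. *)
have := begins_knave_runs t 5 t0; rewrite -/(runs t 5) runsS Rt t5 ts.
exact: begins_prefix.
Qed.

(** * Complements and literal descriptions *)

Lemma next_start_complement s n : next_start (complement s) n = next_start s n.
Proof.
have [lt1 flip cst] := next_startP s n.
have E j : \val (complement s) j = ~~ \val s j by [].
apply: next_start_eq => [//||j jP]; rewrite !E; last by rewrite cst.
by rewrite flip; case: (\val s n).
Qed.

Lemma run_start_complement s n : run_start (complement s) n = run_start s n.
Proof. by apply: eq_iter; apply: next_start_complement. Qed.

Lemma literal_description_complement s : literal_description (complement s) = knave s.
Proof.
apply: calS_inj => j /=; congr (concat _ j); apply/funext => i.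
by rewrite !size_run !run_start_complement /run_bit run_start_complement.
Qed.

(** * Existence and uniqueness of the pair *)

Theorem theorem3 :
  exists S_even S_odd : calS,
    [/\ knave S_odd = S_even /\ knave S_even = S_odd,
        S_even = literal_description (complement S_odd) /\
        S_odd = literal_description (complement S_even)
      & forall A B : calS, knave A = B -> knave B = A ->
          [set A; B] = [set S_even; S_odd]].
Proof.
exists limit, (knave limit).
have limitK : knave (knave limit) = limit by exact: knave2_limit.
rewrite !literal_description_complement; split=> //.
(* The third runs, 3 and 4, break the symmetry: the member with 3 is [limit]. *)
have fixed s t : knave s = t -> knave t = s ->
    size (run s 2) = 3 -> size (run t 2) = 4 -> s = limit.
  move=> st ts s3 t4; have [Rs Rt _] := knave_pair_third_run s t st ts.
  apply: knave2_fixed_unique limit_start1 _ knave2_limit.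
    by apply: (knave_pair_start1 s t); rewrite // runsS ?Rs ?Rt ?s3 ?t4.
  by rewrite /knave2 st.
move=> A B AB BA; have [_ _] := knave_pair_third_run A B AB BA.
case/orP=> /andP[/eqP a3 /eqP b3].
  by have El := fixed A B AB BA a3 b3; rewrite -AB El.
by have El := fixed B A BA AB b3 a3; rewrite -BA El setUC.
Qed.
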